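(* Let $G$ be a non-torsion group (i.e. $G$ contains an element of infinite order). Then the following are equivalent: (i) $G$ is a $2$-Baer group; (ii) $G$ is a generalized $2$-Baer group; (iii) $G$ is a $2$-Engel group.
   Context: A subgroup $H$ of a group $G$ is $2$-subnormal in $G$, written $H\lhd_2 G$, if there is a subgroup $H_1$ with $H\lhd H_1\lhd G$ (repetitions $H=H_1$ or $H_1=G$ are allowed). A group is a $2$-Baer group if all of its cyclic subgroups are $2$-subnormal. For a group $G$, $T_2(G)$ denotes the subgroup generated by all $x\in G$ such that $\langle x\rangle$ is not $2$-subnormal in $G$, with $T_2(G)=1$ if there are no such $x$. $G$ is a generalized $2$-Baer group if $T_2(G)\neq G$. Commutators: $x^y=y^{-1}xy$, $[x,y]=x^{-1}x^y$. A group is $2$-Engel if $[[x,y],y]=1$ for all $x,y\in G$. *)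

(* Defs.v *)
From mathcomp Require Import all_boot.
From mathcomp Require Import boolp classical_sets.

Set Implicit Arguments.
Unset Strict Implicit.
Unset Printing Implicit Defensive.

Local Open Scope classical_set_scope.
Local Open Scope group_scope.

Definition subgroup (G : groupType) (H : set G) : Prop := group_closed (mem H).

Definition generated (G : groupType) (A : set G) : set G :=
  smallest (@subgroup G) A.

Definition cyclic_subgroup (G : groupType) (x : G) : set G := generated [set x].

Definition normal_in (G : groupType) (H K : set G) : Prop :=
  [/\ subgroup H, subgroup K, H `<=` K
    & forall h k : G, H h -> K k -> H (h ^ k)].

Definition two_subnormal (G : groupType) (H : set G) : Prop :=
  exists H1 : set G, normal_in H H1 /\ normal_in H1 [set: G].

Definition two_Baer (G : groupType) : Prop :=
  forall x : G, two_subnormal (cyclic_subgroup x).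

(* If there are no generators this is the trivial subgroup, since every
   subgroup contains 1. *)
Definition T2 (G : groupType) : set G :=
  generated [set x : G | ~ two_subnormal (cyclic_subgroup x)].
Arguments T2 : clear implicits.

Definition generalized_two_Baer (G : groupType) : Prop := T2 G <> [set: G].

Definition two_Engel (G : groupType) : Prop :=
  forall x y : G, [~ x, y, y] = 1.

Definition non_torsion (G : groupType) : Prop :=
  exists x : G, forall n : nat, (0 < n)%N -> x ^+ n <> 1.

(* Main.v *)
Require Import Defs.
From mathcomp Require Import all_boot.
From mathcomp Require Import boolp classical_sets.

Set Implicit Arguments.
Unset Strict Implicit.
Unset Printing Implicit Defensive.

Local Open Scope classical_set_scope.
Local Open Scope group_scope.

(** The substance is that a non-torsion group [G] with [T2 G <> G] is
2-Engel.  The 2-Engel law says that every element commutes with all its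
conjugates; call such an element Engel.

An element [x] of infinite order with [<x>] 2-subnormal is Engel
([two_subnormal_engel]): [<x>] and [<x ^ g>] normalize each other, so
[[x, x ^ g]] is a power of [x] that commutes with [x ^ g], and this forces it
to have finite order.  If instead [g] has finite order and [<g>] is
2-subnormal, then [g] lies in a normal torsion subgroup, because every
conjugate of [<g>] is finite and normal in a common normal subgroup
([two_subnormal_torsion]).

Now let [T] be a proper subgroup such that [<x>] is 2-subnormal for every [x]
outside [T].  If all these [x] had finite order, then so would every product
of two of them, hence every element of [G]; so some [x] outside [T] has
infinite order and is Engel.  A torsion element [y] outside [T] lies in a
normal torsion subgroup [N], and a suitable power [w] of [x] commutes with any
finitely many given elements of [N].  Then [w * y] can be taken outside [T],
it has infinite order, so it is Engel, and cancelling [w] shows that [y]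
commutes with a given conjugate ([outside_engel]).

It remains to pass from the complement of [T] to [T].  Fix [x] outside [T].
For [t] and [u] in [T], the four elements [x], [x * t], [x / u] and
[x / u * t] are outside [T], hence Engel, and a commutator computation in the
abelian normal closures of [x] and [x * t] shows that [t] commutes with
[t ^ u] ([engel_coset_commute]); the computation starts from the fact that
[t] commutes with [t ^ x], which covers the conjugates by elements outside
[T]. *)

(** * Generalities on commuting elements and subgroups *)

Lemma commute_conjg (G : groupType) (x y g : G) :
  commute x y -> commute (x ^ g) (y ^ g).
Proof. by rewrite /commute -!conjMg => ->. Qed.

Lemma conjg_commute (G : groupType) (x y : G) : commute x y -> x ^ y = x.
Proof. by move=> /commgP/conjg_fixP. Qed.

Lemma commute_cancelr (G : groupType) (x y z : G) :
  commute x (y * z) -> commute x z -> commute x y.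
Proof. by move=> cxyz /commuteV/(commuteM cxyz); rewrite mulgK. Qed.

Lemma commute_cancell (G : groupType) (x y z : G) :
  commute x (y * z) -> commute x y -> commute x z.
Proof. by move=> cxyz /commuteV/commuteM/(_ cxyz); rewrite mulKg. Qed.

Lemma subgroupP (G : groupType) (H : set G) :
  subgroup H <-> H 1 /\ forall u v, H u -> H v -> H (u / v).
Proof.
split=> [[H1 HD]|[H1 HD]]; split.
- exact: set_mem.
- by move=> u v /mem_set Hu /mem_set Hv; apply: set_mem; apply: HD.
- exact: mem_set.
- by move=> u v /set_mem Hu /set_mem Hv; apply/mem_set/HD.
Qed.

Lemma subgroup1 (G : groupType) (H : set G) : subgroup H -> H 1.
Proof. by case/subgroupP. Qed.

Lemma subgroupV (G : groupType) (H : set G) (u : G) :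
  subgroup H -> H u -> H u^-1.
Proof. by case/subgroupP=> H1 HD Hu; rewrite -div1g; apply: HD. Qed.

Lemma subgroupM (G : groupType) (H : set G) (u v : G) :
  subgroup H -> H u -> H v -> H (u * v).
Proof.
move=> gH Hu Hv; rewrite -[v]invgK; have [_ HD] := (subgroupP H).1 gH.
by apply: HD => //; apply: subgroupV.
Qed.

Lemma generated_subgroup (G : groupType) (A : set G) : subgroup (generated A).
Proof.
apply/subgroupP; split=> [H [gH _]|u v Au Av H [gH AH]]; first exact: subgroup1.
by have [_ HD] := (subgroupP H).1 gH; apply: HD; [apply: Au | apply: Av].
Qed.

Lemma cyclic_gen (G : groupType) (x : G) : cyclic_subgroup x x.
Proof. by move=> H [_]; apply. Qed.

Lemma cyclicP (G : groupType) (x z : G) :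
  cyclic_subgroup x z -> exists n, z = x ^+ n \/ z^-1 = x ^+ n.
Proof.
have xC m n : commute (x ^+ m) (x ^+ n) by apply: commuteX2.
pose S := [set z : G | exists m n, z = x ^+ m / x ^+ n].
have gS : subgroup S.
  apply/subgroupP; split; first by exists 0%N, 0%N; rewrite divgg.
  move=> _ _ [a [b ->]] [c [d ->]]; exists (a + d)%N, (b + c)%N.
  rewrite expgnDr addnC expgnDr invgF invgM !mulgA; congr (_ * _).
  rewrite -!mulgA; congr (_ * _); apply/commute_sym/commuteV.
  exact: xC.
move=> /(_ S) [|m [n ->]].
  by split=> // _ ->; exists 1%N, 0%N; rewrite expg1 expg0 divg1.
case/orP: (leq_total n m) => [le_nm|le_mn].
  by exists (m - n)%N; left; rewrite expgnFr.
by exists (n - m)%N; right; rewrite expgnFr // invgF.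
Qed.

(** The intermediate subgroup [H1] in the definition of 2-subnormality,
unpacked. *)
Lemma two_subnormalE (G : groupType) (x : G) :
    two_subnormal (cyclic_subgroup x) ->
  exists H1 : set G, [/\ subgroup H1, H1 x, forall h g, H1 h -> H1 (h ^ g)
    & forall a h, cyclic_subgroup x a -> H1 h -> cyclic_subgroup x (a ^ h)].
Proof.
move=> [H1 [[_ gH1 sxH1 nx] [_ _ _ nH1]]]; exists H1; split=> //.
- by apply: sxH1; apply: cyclic_gen.
- by move=> h g Hh; apply: nH1.
Qed.

(** * Torsion elements *)

Definition torsion (G : groupType) (x : G) := exists2 n, 0 < n & x ^+ n = 1.

Lemma torsion_root (G : groupType) (x : G) n :
  0 < n -> torsion (x ^+ n) -> torsion x.
Proof.
by move=> n_gt0 [m m_gt0 xnm]; exists (n * m)%N; rewrite ?muln_gt0 ?n_gt0 ?expgnA.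
Qed.

Lemma torsionX (G : groupType) (x : G) n : torsion x -> torsion (x ^+ n).
Proof. by case=> m m0 xm; exists m => //; rewrite expgnAC xm expg1n. Qed.

Lemma torsionV (G : groupType) (x : G) : torsion x -> torsion x^-1.
Proof. by case=> m m0 xm; exists m => //; rewrite expVgn xm invg1. Qed.

Lemma torsionJ (G : groupType) (x g : G) : torsion x -> torsion (x ^ g).
Proof. by case=> m m0 xm; exists m => //; rewrite -conjXg xm conj1g. Qed.

Lemma torsion_cyclic (G : groupType) (x z : G) :
  torsion x -> cyclic_subgroup x z -> torsion z.
Proof.
move=> tx /cyclicP [n [->|zV]]; first exact: torsionX.
by rewrite -[z]invgK zV; apply/torsionV/torsionX.
Qed.

(** Modulo the torsion group [K], the element [z * k] is [z]. *)
Lemma torsion_mulr (G : groupType) (K : set G) (z k : G) :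
    subgroup K -> (forall a, K a -> K (a ^ z)) -> (forall a, K a -> torsion a) ->
  torsion z -> K k -> torsion (z * k).
Proof.
move=> gK nK tK [n n_gt0 zn] Kk.
have zkX m : exists2 a, K a & (z * k) ^+ m = z ^+ m * a.
  elim: m => [|m [a Ka IHm]]; first by exists 1; rewrite ?mulg1 //; exact: subgroup1.
  exists (a ^ z * k); first by apply: subgroupM => //; apply: nK.
by rewrite expgSr IHm expgSr -!mulgA mulVKg.
apply: (torsion_root n_gt0); have [a Ka ->] := zkX n.
by rewrite zn mul1g; apply: tK.
Qed.

(** The conjugates of [g] generate a torsion group: each of them normalizes the
finite group generated by any other one, so multiplying by one more conjugate
preserves torsion. *)
Lemma two_subnormal_torsion (G : groupType) (g : G) :
    two_subnormal (cyclic_subgroup g) -> torsion g ->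
  exists N : set G, [/\ subgroup N, forall z h, N z -> N (z ^ h), N g
    & forall z, N z -> torsion z].
Proof.
move=> /two_subnormalE [H1 [gH1 H1g nH1 ng]] tg.
(* Asking that multiplication by [z] preserve torsion in [H1] makes closure
   under products immediate. *)
pose N := [set z : G | H1 z /\ forall w, H1 w -> torsion w -> torsion (w * z)].
have Nt z : N z -> torsion z.
  move=> [_ /(_ 1)]; rewrite mul1g; apply; first exact: subgroup1.
  by exists 1%N; rewrite ?expg1.
have N1 : N 1 by split=> [|w _]; [exact: subgroup1 | rewrite mulg1].
have NM u v : N u -> N v -> N (u * v).
  move=> [Hu Nu] [Hv Nv]; split=> [|w Hw tw]; first exact: subgroupM.
  by rewrite mulgA; apply: Nv; [apply: subgroupM | apply: Nu].
have NX u n : N u -> N (u ^+ n).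
  by move=> Nu; elim: n => [|n IHn]; rewrite ?expg0 // expgS; apply: NM.
exists N; split=> //.
- apply/subgroupP; split=> // u v Nu Nv; apply: NM => //.
  have [[//|n] _ vn] := Nt v Nv.
  by rewrite (@mulg1_eq _ v (v ^+ n)) -?expgS //; apply: NX.
- move=> z h [Hz Nz]; split=> [|w Hw tw]; first exact: nH1.
  rewrite -[w](conjgKV h) -conjMg; apply/torsionJ/Nz; first exact: nH1.
  exact: torsionJ.
split=> // w Hw tw; apply: (@torsion_mulr _ (cyclic_subgroup g)) => //.
- exact: generated_subgroup.
- by move=> a ga; apply: ng.
- by move=> a; apply: torsion_cyclic.
- exact: cyclic_gen.
Qed.

(** * Engel elements *)

Definition engel_elt (G : groupType) (x : G) := forall g, commute x (x ^ g).

Lemma engel_eltP (G : groupType) : two_Engel G <-> forall x : G, engel_elt x.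
Proof.
split=> [E y x|E x y].
  have /commgP : [~ [~ x, y], y] == 1 by rewrite E.
  move/commute_sym; rewrite commgEr => /commute_cancelr/(_ (commute_refl y)).
  by move/commuteV; rewrite conjVg invgK.
apply/eqP/commgP/commute_sym; rewrite commgEr; apply: commuteM => //.
by rewrite conjVg; apply/commuteV/E.
Qed.

Lemma engel_conj_commute (G : groupType) (x g h : G) :
  engel_elt x -> commute (x ^ g) (x ^ h).
Proof.
move=> Ex; have := commute_conjg g (Ex (h * g^-1)).
by rewrite -conjgM mulgVK.
Qed.

(** The commutators [[t, x]] all lie in the normal closure of [x], which is
abelian. *)
Lemma engel_commg_commute (G : groupType) (x t u v : G) :
  engel_elt x -> commute [~ t, x] ([~ u, x] ^ v).
Proof.
move=> Ex; have comm_xR a b c : commute (x ^ c) ([~ a, x] ^ b).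
  rewrite commgEr conjMg 2!conjVg -conjgM.
  by apply: commuteM; first apply: commuteV; apply: engel_conj_commute.
have cxR := comm_xR u v; apply: commute_sym; rewrite [in X in commute _ X]commgEr.
apply: commuteM; last by rewrite -[x in X in commute _ X]conjg1; apply: commute_sym.
by rewrite conjVg; apply/commuteV/commute_sym.
Qed.

(** Expand the fact that [x * t] commutes with
[(x * t) ^ x = x * t * [t, x]], and use that [x] commutes with [[t, x]]. *)
Lemma engel_mul_commute (G : groupType) (x t : G) :
  engel_elt x -> engel_elt (x * t) -> commute t (t ^ x).
Proof.
move=> Ex Ext; have tx : t ^ x = t * [~ t, x] by rewrite commgEl mulVKg.
have cxe : commute x [~ t, x].
  rewrite commgEr; apply: commuteM => //.
  by rewrite conjVg; apply/commuteV/Ex.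
have := Ext x; rewrite conjMg (conjg_commute (commute_refl x)) tx.
move: [~ t, x] cxe => e cxe.
rewrite /commute -!mulgA => /mulgI/mulgI; rewrite [RHS]mulgA -cxe -mulgA.
by move/mulgI => ->.
Qed.

(** With [e = [t, x]]: [e] commutes with [[u, t]] because [[u, x * t]] is
[[u, t]] times a conjugate of [[u, x]], while [t ^ x = t * e] commutes with
[t] and [t ^ u], hence with [[u, t]].  Dividing, [t] commutes with [[u, t]]. *)
Lemma engel_coset_commute (G : groupType) (x t u : G) :
    engel_elt x -> engel_elt (x * t) -> engel_elt (x / u) ->
  engel_elt (x / u * t) -> commute t (t ^ u).
Proof.
move=> Ex Ext Exu Exut.
have ct := engel_mul_commute Ex Ext.
have tx : t ^ x = t * [~ t, x] by rewrite commgEl mulVKg.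
have cte : commute t [~ t, x] by apply: commute_cancell (commute_refl t); rewrite -tx.
have ce : commute [~ t, x] [~ u, t].
  have Et : [~ t, x * t] = [~ t, x].
    by rewrite commgEl conjgM tx conjMg !conjg_commute ?mulKg //; apply: commute_sym.
  have Eu : [~ u, x * t] = [~ u, t] * [~ u, x] ^ t.
    rewrite !commgEl conjgM [(u^-1 * _) ^ t]conjMg conjVg -[RHS]mulgA.
    by rewrite mulVKg.
  have := engel_commg_commute t u 1 Ext; rewrite Et conjg1 Eu => /commute_cancelr.
  by apply; apply: engel_commg_commute.
have ctu : commute (t ^ x) (t ^ u).
  have := commute_conjg u (engel_mul_commute Exu Exut).
  by rewrite -conjgM mulgVK => /commute_sym.
have ctR : commute (t ^ x) [~ u, t].
  rewrite commgEr conjVg; apply: commuteM; first exact: commuteV.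
  exact: commute_sym.
have cRt : commute [~ u, t] t.
  by apply: commute_cancelr (commute_sym ce); rewrite -tx; apply: commute_sym.
have := commute_sym cRt; rewrite commgEr => /commute_cancelr.
by move=> /(_ (commute_refl t))/commuteV; rewrite conjVg invgK.
Qed.

(** The subgroups [<x>] and [<x ^ g>] normalize each other, so their
commutator lies in both; the second membership is stated after conjugating
back by [g]. *)
Lemma two_subnormal_conj (G : groupType) (x g : G) :
    two_subnormal (cyclic_subgroup x) ->
  cyclic_subgroup x [~ x, x ^ g] /\ cyclic_subgroup x ([~ x, x ^ g] ^ g^-1).
Proof.
move=> /two_subnormalE [H1 [gH1 H1x nH1 nx]]; have gC := generated_subgroup [set x].
split.
  rewrite commgEl; apply: (subgroupM gC); first by apply: (subgroupV gC); apply: cyclic_gen.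
  by apply: nx; [exact: cyclic_gen | exact: nH1].
rewrite conjRg conjgK commgEr; apply: (subgroupM gC); last exact: cyclic_gen.
by apply: nx; [apply: (subgroupV gC); apply: cyclic_gen | exact: nH1].
Qed.

Lemma cyclic_commute (G : groupType) (x z : G) : cyclic_subgroup x z -> commute x z.
Proof.
move=> /cyclicP [n [->|zV]]; first exact: commuteX.
by rewrite -[z]invgK zV; apply/commuteV/commuteX.
Qed.

(** The commutator of [x] and [x ^ g] lies in [<x>] and in [<x ^ g>], so it is a
power of [x] centralized by both. *)
Lemma two_subnormal_engel (G : groupType) (x : G) :
  two_subnormal (cyclic_subgroup x) -> ~ torsion x -> engel_elt x.
Proof.
move=> sx ntx g; have [xc /cyclic_commute/(commute_conjg g)] := two_subnormal_conj g sx.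
rewrite conjgKV => cyc; have cxc := cyclic_commute xc.
apply/commgP/eqP; set y := x ^ g in xc cyc cxc *; set c := [~ x, y] in xc cyc cxc *.
have xy : x ^ y = x * c by rewrite /c commgEl mulVKg.
(* Conjugating [x ^+ n = c] or [c^-1] by [y], which centralizes [c],
   multiplies the left side by [c ^+ n]. *)
have [n xn] := cyclicP xc; have cy : c ^ y = c by apply/conjg_commute/commute_sym.
have xny : (x ^+ n) ^ y = x ^+ n.
  by case: xn => <-; rewrite ?conjVg cy.
have cn : c ^+ n = 1.
  by apply: (mulgI (x ^+ n)); rewrite mulg1 -expgMn // -xy -conjXg.
have xnn : (x ^+ n) ^+ n = 1.
  by case: xn => <-; rewrite ?expVgn cn ?invg1.
case: n xn {xny cn} xnn => [|n] xn xnn; last first.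
  by case: ntx; exists (n.+1 * n.+1)%N; rewrite ?expgnA.
by case: xn; rewrite expg0 // => cV; rewrite -[c]invgK cV invg1.
Qed.

(** * Proper subgroups with 2-subnormal complement *)

(** If [x] is in [T] and [g] is a torsion element outside [T], then [x * g] is
outside [T], and modulo the torsion normal closure of [g] it is [x]. *)
Lemma exists_infinite_order_outside (G : groupType) (T : set G) :
    subgroup T -> (exists g, ~ T g) ->
    (forall x, ~ T x -> two_subnormal (cyclic_subgroup x)) ->
    (exists x : G, ~ torsion x) ->
  exists x, ~ T x /\ ~ torsion x.
Proof.
move=> gT [g nTg] sT [x ntx].
have [Tx|nTx] := EM (T x); last by exists x.
have [tg|ntg] := EM (torsion g); last by exists g.
have [N [gN nN Ng tN]] := two_subnormal_torsion (sT g nTg) tg.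
exists (x * g); split=> [Txg|txg].
  apply: nTg; rewrite -[g](mulKg x); apply: subgroupM => //; exact: subgroupV.
apply: ntx; rewrite -[x](mulgK g).
by apply: (torsion_mulr gN) => // [a|]; [apply: nN | apply: subgroupV].
Qed.

(** The commutator of [x] and [n] has finite order and commutes with [x]. *)
Lemma engel_power_commute (G : groupType) (N : set G) (x n : G) :
    subgroup N -> (forall z h, N z -> N (z ^ h)) ->
    (forall z, N z -> torsion z) -> engel_elt x -> N n ->
  exists2 m, 0 < m & commute (x ^+ m) n.
Proof.
move=> gN nN tN Ex Nn; have xn : x ^ n = x * [~ x, n] by rewrite commgEl mulVKg.
have [m m_gt0 cm] : torsion [~ x, n].
  apply: tN; rewrite commgEr; apply: subgroupM => //.
  by apply: nN; apply: subgroupV.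
exists m => //; apply/commgP/conjg_fixP; rewrite conjXg xn expgMn ?cm ?mulg1 //.
by rewrite commgEl; apply: commuteM; first exact: commuteV.
Qed.

Lemma commute_conj_cancel (G : groupType) (w y g : G) :
    commute w (w ^ g) -> commute w (y ^ g) -> commute (w ^ g) y ->
  commute (w * y) ((w * y) ^ g) -> commute y (y ^ g).
Proof.
rewrite conjMg => cww cwy cwgy cwywy.
have cw : commute w (w ^ g * y ^ g) by apply: commuteM.
have cy : commute y (w ^ g * y ^ g).
  by apply: commute_sym; apply: commute_cancell (commute_sym cw); apply: commute_sym.
by apply: commute_cancell cy _; apply: commute_sym.
Qed.

(** A torsion element [y] is compared with [w * y], where [w] is a power of [x]
that commutes with [y ^ g] and with [y ^ g^-1]; [w * y] has infinite order
because it is [w] modulo the torsion normal closure of [y]. *)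
Lemma outside_engel (G : groupType) (T : set G) (x y : G) :
    subgroup T -> (forall x, ~ T x -> two_subnormal (cyclic_subgroup x)) ->
    ~ T x -> ~ torsion x ->
  ~ T y -> engel_elt y.
Proof.
move=> gT sT nTx ntx nTy; have Ex := two_subnormal_engel (sT x nTx) ntx.
have [ty|] := EM (torsion y); last exact/two_subnormal_engel/sT.
have [N [gN nN Ny tN]] := two_subnormal_torsion (sT y nTy) ty.
move=> g; have pw := engel_power_commute gN nN tN Ex.
have [m1 m1_gt0 c1] := pw _ (nN _ g Ny).
have [m2 m2_gt0 c2] := pw _ (nN _ g^-1 Ny).
pose m := (m1 * m2)%N; have m_gt0 : 0 < m by rewrite muln_gt0 m1_gt0.
(* If [x ^+ m * y] and [x ^+ (2 * m) * y] were both in [T], so would [y] be. *)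
have [k k_gt0 nTk] : exists2 k, 0 < k & ~ T ((x ^+ m) ^+ k * y).
  have [T1|] := EM (T (x ^+ m * y)); last by exists 1%N; rewrite ?expg1.
  exists 2%N => // T2; apply: nTy; rewrite expg2 -mulgA in T2.
  have Txm : T (x ^+ m).
    by rewrite -[x ^+ m](mulgK (x ^+ m * y)); apply: subgroupM (subgroupV _ _).
  by rewrite -[y](mulKg (x ^+ m)); apply: subgroupM => //; apply: subgroupV.
have mE i z j : commute (x ^+ i) z -> m = (i * j)%N -> commute ((x ^+ m) ^+ k) z.
  move=> ciz ->; rewrite expgnA; apply: commute_sym.
  by do 2!apply: commuteX; apply: commute_sym.
have cmy : commute ((x ^+ m) ^+ k) (y ^ g).
  exact: mE c1 _.
have cmyV : commute ((x ^+ m) ^+ k) (y ^ g^-1).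
  by apply: mE c2 _; rewrite /m mulnC.
apply: (@commute_conj_cancel _ ((x ^+ m) ^+ k)) => //.
- by rewrite -expgnA conjXg; apply/commuteX2/Ex.
- by rewrite -[y](conjgKV g); apply: commute_conjg.
apply: (two_subnormal_engel (sT _ nTk)) => twy.
apply: ntx; apply: (torsion_root m_gt0); apply: (torsion_root k_gt0).
rewrite -[_ ^+ k](mulgK y).
by apply: (torsion_mulr gN) => // [a|]; [apply: nN | apply: subgroupV].
Qed.

Lemma engel_of_outside (G : groupType) (T : set G) :
    subgroup T -> (exists x, ~ T x) -> (forall x, ~ T x -> engel_elt x) ->
  two_Engel G.
Proof.
move=> gT [x nTx] ET; apply/engel_eltP => t.
have [Tt|] := EM (T t); last exact: ET.
have nTM y s : ~ T y -> T s -> ~ T (y * s).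
  move=> nTy Ts Tys; apply: nTy; rewrite -[y](mulgK s).
  by apply: subgroupM => //; apply: subgroupV.
move=> u; have [Tu|nTu] := EM (T u).
  have nTxu : ~ T (x / u) by apply: nTM => //; apply: subgroupV.
  by apply: (@engel_coset_commute _ x) => //; apply: ET => //; apply: nTM.
by apply: engel_mul_commute; apply: ET => //; apply: nTM.
Qed.

(** * The equivalence *)

Lemma two_Baer_generalized (G : groupType) :
  non_torsion G -> two_Baer G -> generalized_two_Baer G.
Proof.
move=> [x ntx] BG T2G.
have sT2 : T2 G `<=` [set 1].
  apply: smallest_sub => [|z /(_ (BG z)) //].
  by apply/subgroupP; split=> // u v -> ->; rewrite divgg.
have : T2 G x by rewrite T2G.
by move=> /sT2 x1; apply: (ntx 1%N) => //; rewrite x1 expg1.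
Qed.

Lemma generalized_two_Baer_engel (G : groupType) :
  non_torsion G -> generalized_two_Baer G -> two_Engel G.
Proof.
move=> [x0 ntx0] GB; have gT : subgroup (T2 G) := generated_subgroup _.
have sT x : ~ T2 G x -> two_subnormal (cyclic_subgroup x).
  move=> nTx; apply: contrapT => nsx; apply: nTx => H [_]; exact.
have pT : exists g, ~ T2 G g.
  apply: contrapT => nT; apply: GB; rewrite eqEsubset; split=> // g _.
  by apply: contrapT => nTg; apply: nT; exists g.
have [|x [nTx ntx]] := exists_infinite_order_outside gT pT sT.
  by exists x0 => -[n n_gt0]; apply: ntx0.
by apply: (engel_of_outside gT pT) => y; apply: (outside_engel gT sT nTx ntx).
Qed.

(** The centralizer of the conjugates of [x] serves as intermediate subgroup:
it is normal, and contains [x] as [x] is Engel. *)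
Lemma two_Engel_Baer (G : groupType) : two_Engel G -> two_Baer G.
Proof.
move=> /engel_eltP EG x; pose C := [set z : G | forall g, commute (x ^ g) z].
have gC : subgroup C.
  apply/subgroupP; split=> [g|u v Cu Cv g]; first exact: commute1.
  by apply: commuteM => //; apply: commuteV.
have Cx : C x by move=> g; apply/commute_sym/EG.
have sxC : cyclic_subgroup x `<=` C by apply: smallest_sub => // _ ->.
have gx := generated_subgroup [set x].
exists C; split; split=> //.
- move=> h k xh Ck; suff -> : h ^ k = h by [].
  apply: conjg_commute; have {Ck}/commute_sym ck := Ck 1.
  have {}ck : commute k x by move: ck; rewrite conjg1.
  apply: commute_sym; have [n [->|hV]] := cyclicP xh; first exact: commuteX.
  by rewrite -[h]invgK hV; apply/commuteV/commuteX.
- by apply/subgroupP; split.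
- move=> h k Ch _ g; have := commute_conjg k (Ch (g * k^-1)).
  by rewrite -conjgM mulgVK.
Qed.

Theorem theorem2p5 (G : groupType) (hG : non_torsion G) :
  [<-> two_Baer G; generalized_two_Baer G; two_Engel G].
Proof.
tfae.
- exact: two_Baer_generalized.
- exact: generalized_two_Baer_engel.
- exact: two_Engel_Baer.
Qed.
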